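(* Let $\Omega\subset\mathbb{R}^4$ be a bounded smooth domain, $\lambda_1,\lambda_2\in\mathbb{R}$ and $\mu_1,\mu_2>0$. Assume that $\mu_1<\mu_2$ and $\mu_1<\beta<\mu_2$. If $\theta_2<0<\theta_1$ and $$-\theta_1\log\left(\frac{\theta_1}{\beta-\mu_1}\right)+\theta_2\log\left(\frac{\theta_2}{\beta-\mu_2}\right)+\theta_1-\theta_2+\lambda_2-\lambda_1>0,$$ then the system $$-\Delta u=\lambda_1u+\mu_1|u|^2u+\beta|v|^2u+\theta_1u\log u^2,\quad -\Delta v=\lambda_2v+\mu_2|v|^2v+\beta|u|^2v+\theta_2v\log v^2\ \text{ in }\Omega,\quad u=v=0\ \text{ on }\partial\Omega$$ has no positive solutions.
   Context: Solutions are weak solutions $(u,v)\in H_0^1(\Omega)\times H_0^1(\Omega)$; a solution $(u,v)$ is positive if both $u>0$ and $v>0$ in $\Omega$. *)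

(* Defs.v *)
From HB Require Import structures.
From mathcomp Require Import all_boot all_order all_algebra.
From mathcomp Require Import all_classical all_reals all_analysis.

Set Implicit Arguments.
Unset Strict Implicit.
Unset Printing Implicit Defensive.

Import Order.TTheory GRing.Theory Num.Theory.
Import numFieldNormedType.Exports.

Local Open Scope classical_set_scope.
Local Open Scope ring_scope.

(* The product sigma-algebra on R^n, presented as the library does for tuples;
   it coincides with the Borel sigma-algebra. *)
Section measurable_rV.
Context (R : realType) (n : nat).

Let coord (i : 'I_n) (x : 'rV[R]_n) : R := x ord0 i.

Let rV_set0 : g_sigma_preimage coord set0.
Proof. exact: sigma_algebra0. Qed.

Let rV_setC A : g_sigma_preimage coord A -> g_sigma_preimage coord (~` A).
Proof. exact: sigma_algebraC. Qed.

Let rV_bigcup (F : _^nat) : (forall i, g_sigma_preimage coord (F i)) ->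
  g_sigma_preimage coord (\bigcup_i (F i)).
Proof. exact: sigma_algebra_bigcup. Qed.

HB.instance Definition _ := @isMeasurable.Build default_measure_display
  'rV[R]_n (g_sigma_preimage coord) rV_set0 rV_setC rV_bigcup.

End measurable_rV.

Lemma measurable_fun_rV d (T : measurableType d) (R : realType) (n : nat)
    (f : T -> 'rV[R]_n) :
  (forall i, measurable_fun setT (fun x => f x ord0 i)) ->
  measurable_fun setT f.
Proof.
move=> mf.
have : g_sigma_preimage (fun (i : 'I_n) (x : 'rV[R]_n) => x ord0 i) `<=`
    [set A | measurable (f @^-1` A)].
  apply: smallest_sub.
    split=> [|A /= mA|F /= mF].
    - by rewrite /= preimage_set0.
    - by rewrite setTD preimage_setC; exact: measurableC.
    - by rewrite preimage_bigcup; exact: bigcup_measurable.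
  rewrite -bigcup_seq; apply: bigcup_sub => i _ _ [B mB <-] /=.
  by rewrite setTI -comp_preimage -[X in measurable X]setTI; exact: mf.
by move=> sub _ A mA; rewrite setTI; exact: sub.
Qed.

(* Lebesgue measure on R^4: the image of the fourfold product of the
   one-dimensional Lebesgue measure under (a, b, c, d) |-> row vector. *)
Section lebesgue4.
Context (R : realType).

Definition row4 (p : R * R * R * R) : 'rV[R]_4 :=
  \row_i [:: p.1.1.1; p.1.1.2; p.1.2; p.2]`_i.

Lemma measurable_row4 : measurable_fun setT row4.
Proof.
apply: measurable_fun_rV => i; rewrite /row4.
under eq_fun do rewrite mxE.
case: i => [[|[|[|[|//]]]] ?] /=.
- by do 2 apply: measurableT_comp => //.
- by do 2 apply: measurableT_comp => //.
- by apply: measurableT_comp.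
- exact: measurable_snd.
Qed.

Let mu := @lebesgue_measure R.

Definition lebesgue4 : set 'rV[R]_4 -> \bar R :=
  pushforward (mu \x mu \x mu \x mu)%E row4.

Let lebesgue4_set0 : lebesgue4 set0 = 0%E.
Proof. by rewrite /lebesgue4 /pushforward preimage_set0 measure0. Qed.

Let lebesgue4_ge0 A : (0 <= lebesgue4 A)%E.
Proof. by rewrite /lebesgue4 /pushforward; exact: measure_ge0. Qed.

Let lebesgue4_sigma_additive : semi_sigma_additive lebesgue4.
Proof.
have pre A : measurable A -> measurable (row4 @^-1` A).
  by move=> mA; rewrite -[X in measurable X]setTI; exact: measurable_row4.
move=> F mF tF mUF; rewrite /lebesgue4 /pushforward preimage_bigcup.
apply: measure_semi_sigma_additive.
- by move=> n; exact: pre.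
- apply/trivIsetP => /= i j _ _ ij; rewrite -preimage_setI.
  by move/trivIsetP : tF => /(_ _ _ _ _ ij) ->//; rewrite preimage_set0.
- by rewrite -preimage_bigcup; exact: pre.
Qed.

HB.instance Definition _ := isMeasure.Build _ _ _ lebesgue4
  lebesgue4_set0 lebesgue4_ge0 lebesgue4_sigma_additive.

End lebesgue4.

Section smooth.
Context (R : realType).

Definition partial n (i : 'I_n) (f : 'rV[R]_n -> R) : 'rV[R]_n -> R :=
  'D_(delta_mx ord0 i : 'rV[R]_n) f.

Definition iter_partial n (s : seq 'I_n) (f : 'rV[R]_n -> R) : 'rV[R]_n -> R :=
  foldr (@partial n) f s.

(* C^oo: all iterated partial derivatives exist and are continuous. *)
Definition smooth n (f : 'rV[R]_n -> R) : Prop :=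
  forall s : seq 'I_n, continuous (iter_partial s f) /\
    forall (i : 'I_n) (x : 'rV[R]_n),
      derivable (iter_partial s f) x (delta_mx ord0 i : 'rV[R]_n).

(* Near every boundary point, up to the choice of a coordinate axis and of its
   orientation, Omega is the strict epigraph of a smooth function of the other
   coordinates. *)
Definition smooth_boundary n (Omega : set 'rV[R]_n.+1) : Prop :=
  forall p, (closure Omega `\` interior Omega) p ->
    exists (i : 'I_n.+1) (b : bool) (gamma : 'rV[R]_n -> R),
      smooth gamma /\
      \forall x \near p,
        Omega x <-> gamma (col' i x) < (-1) ^+ b * x ord0 i.

Definition bounded_smooth_domain n (Omega : set 'rV[R]_n.+1) : Prop :=
  [/\ Omega !=set0, open Omega, connected Omega, bounded_set Omega
    & smooth_boundary Omega].

End smooth.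

Section sobolev.
Context (R : realType).
Local Notation E := 'rV[R]_4.
Local Notation mu := (@lebesgue4 R).
Implicit Types (Omega : set E) (u g phi : E -> R).

Definition L2 Omega u : Prop := u \_ Omega \in Lfun mu 2%:E.

Definition normL2 Omega u : \bar R := Lnorm mu 2%:E (EFin \o (u \_ Omega)).

(* C_c^oo(Omega), its elements being extended by zero outside Omega. *)
Definition test_function Omega phi : Prop :=
  [/\ smooth phi, compact (closure [set x | phi x != 0])
    & closure [set x | phi x != 0] `<=` Omega].

(* g is the i-th weak partial derivative of u. *)
Definition is_weak_partial Omega (i : 'I_4) u g : Prop :=
  forall phi, test_function Omega phi ->
    (\int[mu]_(x in Omega) (u x * partial i phi x)%:E =
     - \int[mu]_(x in Omega) (g x * phi x)%:E)%E.

(* A representative of the weak partial derivative of u when the latter exists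
   in L^2(Omega), and 0 otherwise. *)
Definition weak_partial Omega (i : 'I_4) u : E -> R :=
  xget (cst 0) [set g | L2 Omega g /\ is_weak_partial Omega i u g].

Definition H1 Omega u : Prop :=
  L2 Omega u /\ forall i, exists g, L2 Omega g /\ is_weak_partial Omega i u g.

Definition normH1 Omega u : \bar R :=
  ((normL2 Omega u ^+ 2 + \sum_(i < 4) normL2 Omega (weak_partial Omega i u) ^+ 2)
     `^ 2^-1)%E.

(* H_0^1(Omega): the closure of C_c^oo(Omega) in H^1(Omega). *)
Definition H10 Omega u : Prop :=
  H1 Omega u /\
  forall e : R, 0 < e ->
    exists2 phi, test_function Omega phi & (normH1 Omega (u \- phi)%R < e%:E)%E.

(* u is a weak solution in H_0^1(Omega) of - Delta u = f in Omega, u = 0 on the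
   boundary. The left-hand integral is finite by the Cauchy-Schwarz inequality,
   so the equality of extended reals forces the right-hand one to be finite. *)
Definition weak_solution Omega u (f : E -> R) : Prop :=
  H10 Omega u /\
  forall phi, H10 Omega phi ->
    (\int[mu]_(x in Omega)
       (\sum_(i < 4) weak_partial Omega i u x * weak_partial Omega i phi x)%:E =
     \int[mu]_(x in Omega) (f x * phi x)%:E)%E.

(* Elements of H_0^1(Omega) are classes of functions up to null sets. *)
Definition positive_in Omega u : Prop :=
  {ae mu, forall x, Omega x -> 0 < u x}.

End sobolev.

(* Main.v *)
Require Import Defs.
From mathcomp Require Import all_boot all_order all_algebra.
From mathcomp Require Import all_classical all_reals all_analysis.
From mathcomp Require Import measurable_realfun ring lra.
Import Order.TTheory GRing.Theory Num.Theory.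
Import numFieldNormedType.Exports.
Local Open Scope classical_set_scope.
Local Open Scope ring_scope.

(** Why there is no positive solution: test the equation of u against v and the
    equation of v against u.  Both gradient pairings are the same integral, so
    the right-hand sides f (for u) and g (for v) satisfy
      \int_Omega f v = \int_Omega g u                                      (1)
    ([weak_solution_cross_test]).  For p, q > 0 the values of u and v at a
    point, the difference of the integrands is
      p q [ (lambda2 - lambda1) + ((beta - mu1) p^2 - theta1 ln p^2)
            + ((mu2 - beta) q^2 + theta2 ln q^2) ].
    Both inner parentheses have the form a s - t ln s with a, t > 0, whose
    minimum over s > 0 is attained at s = t / a and equals t - t ln (t / a)
    ([linear_minus_ln_ge]).  The logarithmic hypothesis says exactly that the
    sum of the two minima with lambda2 - lambda1 is positive, whence
    f v < g u almost everywhere in Omega ([reaction_cross_lt]).  A function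
    which is positive almost everywhere in Omega and has integral 0 forces Omega
    to be negligible, and a nonempty open set is not ([open_not_negligible]).

    The only analytic point is that the two sides of (1) may be subtracted.
    The gradients being square integrable, the common value of (1) is finite,
    and a measurable function whose integral is finite is integrable
    ([integral_fin_num_integrable]).  All integrands are extended by zero to the
    whole space, where they are measurable as compositions of Borel functions
    with the extensions by zero of u and v. *)

(** The inequality ln x <= x - 1 at x = a s / t; equality holds at s = t / a. *)
Lemma linear_minus_ln_ge (R : realType) (a t s : R) :
  0 < a -> 0 < t -> 0 < s -> t - t * ln (t / a) <= a * s - t * ln s.
Proof.
move=> a0 t0 s0.
have as0 : 0 < a * s / t by rewrite divr_gt0 ?mulr_gt0.
have lnE : ln (a * s / t) = ln s - ln (t / a).
  rewrite -ln_div ?posrE ?divr_gt0//; congr ln.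
  by field; rewrite !gt_eqF.
have /ler_wpM2l-/(_ t (ltW t0)) : ln (a * s / t) <= a * s / t - 1.
  by rewrite -[X in ln X](subrKC 1) le_ln1Dx//; lra.
have -> : t * (a * s / t - 1) = a * s - t by field; rewrite gt_eqF.
by rewrite lnE mulrBr => h; lra.
Qed.

Section integral.
Context d (T : measurableType d) (R : realType) (mu : {measure set T -> \bar R}).

(** The integral is the difference of those of the positive and negative parts,
    and in the extended reals such a difference is finite only if both terms
    are: the indeterminate form +oo - +oo is -oo. *)
Lemma integral_fin_num_integrable (f : T -> \bar R) :
  measurable_fun [set: T] f -> (\int[mu]_x f x)%E \is a fin_num ->
  mu.-integrable [set: T] f.
Proof.
move=> mf; rewrite integralE => fin.
have [p n] : (\int[mu]_x f^\+ x)%E \is a fin_num /\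
             (\int[mu]_x f^\- x)%E \is a fin_num.
  have : (0 <= \int[mu]_x f^\+ x)%E by exact: integral_ge0.
  have : (0 <= \int[mu]_x f^\- x)%E by exact: integral_ge0.
  move: fin.
  by case: (\int[mu]_x f^\+ x)%E => [?| |]; case: (\int[mu]_x f^\- x)%E => [?| |].
apply/integrableP; split=> //.
rewrite -/(abse \o f) fune_abse ge0_integralD//=.
- by rewrite lte_add_pinfty// -ge0_fin_numE//; apply: integral_ge0.
- exact: measurable_funepos.
- exact: measurable_funeneg.
Qed.

(** Since g is almost everywhere nonnegative, the integral of its absolute value
    vanishes too, so g = 0 almost everywhere; on D this contradicts g > 0 outside
    a null set.  The function g vanishes off D and is integrated over the whole
    space, which makes sense for an arbitrary set D. *)
Lemma ae_gt0_integral_eq0_negligible (D : set T) (g : T -> R) :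
  measurable_fun [set: T] g -> (forall x, ~ D x -> g x = 0) ->
  {ae mu, forall x, D x -> 0 < g x} ->
  (\int[mu]_x (g x)%:E = 0)%E -> mu.-negligible D.
Proof.
move=> mg g0 gpos ig.
have mEg : measurable_fun [set: T] (EFin \o g) by exact/measurable_EFinP.
have : (\int[mu]_x `|(EFin \o g) x| = 0)%E.
  rewrite -ig; apply: ae_eq_integral => //; first exact: measurableT_comp.
  apply: filterS gpos => x gx _ /=; have [/gx gx0|/g0 ->] := pselect (D x).
    by rewrite gtr0_norm.
  by rewrite normr0.
move/ae_eq_integral_abs => /(_ measurableT mEg) g_ae0.
have [N [mN N0 sub]] : {ae mu, forall x, ~ D x}.
  apply: filterS2 gpos g_ae0 => x gx /(_ I) [gx0] Dx.
  by have := gx Dx; rewrite gx0 ltxx.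
by exists N; split=> // x Dx; apply: sub => /(_ Dx).
Qed.

End integral.

Lemma product_measure1_gt0 {d1 d2} {T1 : measurableType d1} {T2 : measurableType d2}
    {R : realType} {m1 : {measure set T1 -> \bar R}}
    {m2 : {sigma_finite_measure set T2 -> \bar R}} {A1 : set T1} {A2 : set T2} :
  measurable A1 -> measurable A2 -> (0 < m1 A1)%E -> (0 < m2 A2)%E ->
  (0 < (m1 \x m2) (A1 `*` A2))%E.
Proof.
by move=> mA1 mA2 pA1 pA2; rewrite product_measure1E//; exact: mule_gt0.
Qed.

Section lebesgue4.
Context {R : realType}.
Local Notation mu := (@lebesgue4 R).

Lemma lebesgue_measure_ball_gt0 (a e : R) : 0 < e ->
  (0 < lebesgue_measure (ball a e))%E.
Proof.
move=> e0; rewrite ball_itv lebesgue_measure_itv/= lte_fin ifT; last lra.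
by rewrite -EFinB lte_fin; lra.
Qed.

(** A ball of the norm of 'rV_4 is a cube, whose preimage under [row4] is a
    product of four intervals and so has positive product measure. *)
Lemma open_not_negligible {Omega : set 'rV[R]_4} :
  open Omega -> Omega !=set0 -> ~ mu.-negligible Omega.
Proof.
move=> oO [p Op] [A [mA A0 OA]].
have /nbhs_ballP[e /= e0 pe] := open_nbhs_nbhs (conj oO Op).
pose I k : set R := ball (p ord0 (inord k)) e.
have sub : I 0%N `*` I 1%N `*` I 2%N `*` I 3%N `<=` @row4 R @^-1` A.
  move=> [[[a b] c] f] /= [[[Ia Ib] Ic] If]; apply/OA/pe.
  split=> // k i; rewrite (ord1 k) /row4 mxE/= -(inord_val i).
  by case: i => [[|[|[|[|//]]]] ?] /=; rewrite !inordK.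
have mI k : measurable (I k) by exact: measurable_ball.
have pos k : (0 < lebesgue_measure (I k))%E by exact: lebesgue_measure_ball_gt0.
have mA4 : measurable (@row4 R @^-1` A).
  by rewrite -[X in measurable X]setTI; exact: measurable_row4.
have mI2 := measurableX (mI 0%N) (mI 1%N).
have mI3 := measurableX mI2 (mI 2%N).
have mI4 := measurableX mI3 (mI 3%N).
move: A0; rewrite /lebesgue4 /= /pushforward /= => A0.
pose leb := @lebesgue_measure R.
have pos2 := product_measure1_gt0 (m1 := leb) (m2 := leb)
  (mI 0%N) (mI 1%N) (pos 0%N) (pos 1%N).
have pos3 := product_measure1_gt0 (m1 := (leb \x leb)%E) (m2 := leb)
  mI2 (mI 2%N) pos2 (pos 2%N).
have := product_measure1_gt0 (m1 := (leb \x leb \x leb)%E) (m2 := leb)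
  mI3 (mI 3%N) pos3 (pos 3%N).
apply/negP; rewrite -leNgt -A0; apply: le_measure => //; exact/mem_set.
Qed.

End lebesgue4.

Section weak_solutions.
Context {R : realType}.
Local Notation E := 'rV[R]_4.
Local Notation mu := (@lebesgue4 R).
Implicit Types (Omega : set E) (u v f g : E -> R).

Lemma L2_measurable {Omega u} : L2 Omega u -> measurable_fun setT (u \_ Omega).
Proof. by case/andP; rewrite inE. Qed.

Lemma L2_weak_partial Omega u i : H1 Omega u -> L2 Omega (weak_partial Omega i u).
Proof. by case=> _ /(_ i) /(xgetPex (cst 0))[]. Qed.

(** Cauchy-Schwarz applied to each partial derivative. *)
Lemma weak_gradient_pairing_fin_num {Omega u v} : H1 Omega u -> H1 Omega v ->
  (\int[mu]_(x in Omega)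
     (\sum_(i < 4) weak_partial Omega i u x * weak_partial Omega i v x)%:E)%E
  \is a fin_num.
Proof.
move=> hu hv; rewrite integral_mkcond.
pose F i : E -> R := (weak_partial Omega i u \_ Omega) \* (weak_partial Omega i v \_ Omega).
have FE : ((fun x => (\sum_(i < 4) weak_partial Omega i u x *
    weak_partial Omega i v x)%:E) \_ Omega) = EFin \o (\sum_(i < 4) F i).
  apply/funext => x; rewrite /= fct_sumE !patchE; case: ifPn => xO.
    by congr EFin; apply: eq_bigr => i _; rewrite /F /= !patchE xO.
  by rewrite big1// => i _; rewrite /F /= !patchE (negbTE xO) mul0r.
rewrite FE.
apply: integrable_fin_num => //; apply/Lfun1_integrable.
by apply: rpred_sum => i _; apply: Lfun2_mul_Lfun1; exact: L2_weak_partial.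
Qed.

Lemma weak_solution_cross_test {Omega u v f g} :
  weak_solution Omega u f -> weak_solution Omega v g ->
  ((\int[mu]_(x in Omega) (f x * v x)%:E)%E \is a fin_num) /\
  (\int[mu]_(x in Omega) (f x * v x)%:E = \int[mu]_(x in Omega) (g x * u x)%:E)%E.
Proof.
move=> [hu uf] [hv vg]; rewrite -(uf _ hv) -(vg _ hu); split.
  exact: weak_gradient_pairing_fin_num hu.1 hv.1.
congr integral; apply/funext => x; congr EFin.
by apply: eq_bigr => i _; rewrite mulrC.
Qed.

(** As a function of the two values p and q, the right-hand side of either
    equation is this one: p is the value of the unknown of that equation, q the
    value of the other unknown. *)
Definition reaction (lambda m beta theta p q : R) : R :=
  lambda * p + m * `|p| ^+ 2 * p + beta * `|q| ^+ 2 * p + theta * p * ln (p ^+ 2).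

Lemma measurable_reaction d (T : measurableType d) (l m b t : R) (f g : T -> R) :
  measurable_fun setT f -> measurable_fun setT g ->
  measurable_fun setT (fun x => reaction l m b t (f x) (g x)).
Proof.
move=> mf mg; rewrite /reaction.
have mN (h : T -> R) : measurable_fun [set: T] h ->
    measurable_fun [set: T] (fun x => `|h x| ^+ 2).
  by move=> mh; apply: measurable_funX; exact: measurableT_comp.
have mln : measurable_fun [set: T] (fun x => ln (f x ^+ 2)).
  by apply: measurableT_comp => //; exact: measurable_funX.
have mNf := mN _ mf; have mNg := mN _ mg.
apply: measurable_funD; last by apply: measurable_funM => //; exact: measurable_funM.
apply: measurable_funD; last by apply: measurable_funM => //; exact: measurable_funM.
apply: measurable_funD; first exact: measurable_funM.
by apply: measurable_funM => //; exact: measurable_funM.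
Qed.

(** Dividing the difference of the two sides by p q > 0 decouples the unknowns:
    it becomes lambda2 - lambda1 plus a function of p^2 plus a function of q^2,
    each bounded below by its minimum. *)
Lemma reaction_cross_lt (lambda1 lambda2 mu1 mu2 beta theta1 theta2 p q : R) :
  mu1 < beta -> beta < mu2 -> theta2 < 0 -> 0 < theta1 ->
  0 < - theta1 * ln (theta1 / (beta - mu1))
      + theta2 * ln (theta2 / (beta - mu2))
      + theta1 - theta2 + lambda2 - lambda1 ->
  0 < p -> 0 < q ->
  reaction lambda1 mu1 beta theta1 p q * q < reaction lambda2 mu2 beta theta2 q p * p.
Proof.
move=> b1 b2 t2 t1 hlog p0 q0.
have p20 : 0 < p ^+ 2 by rewrite exprn_gt0.
have q20 : 0 < q ^+ 2 by rewrite exprn_gt0.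
have h1 : theta1 - theta1 * ln (theta1 / (beta - mu1)) <=
    (beta - mu1) * p ^+ 2 - theta1 * ln (p ^+ 2).
  by apply: linear_minus_ln_ge => //; rewrite subr_gt0.
(* With theta2 and beta - mu2 negative, the same bound holds for the pair of
   their opposites, which has the same quotient. *)
have h2 : - theta2 - - theta2 * ln (theta2 / (beta - mu2)) <=
    (mu2 - beta) * q ^+ 2 - - theta2 * ln (q ^+ 2).
  have -> : theta2 / (beta - mu2) = - theta2 / (mu2 - beta).
    by rewrite -(opprB mu2 beta) invrN mulrN mulNr.
  by apply: linear_minus_ln_ge => //; lra.
rewrite -subr_gt0 /reaction (gtr0_norm p0) (gtr0_norm q0).
set Lp := ln (p ^+ 2) in h1 *; set Lq := ln (q ^+ 2) in h2 *.
suff : 0 < (p * q) * ((lambda2 - lambda1) + ((beta - mu1) * p ^+ 2 - theta1 * Lp)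
    + ((mu2 - beta) * q ^+ 2 - - theta2 * Lq)).
  by congr (_ < _); ring.
by rewrite mulr_gt0 ?mulr_gt0//; lra.
Qed.

End weak_solutions.

Theorem theorem1p6 (R : realType) (Omega : set 'rV[R]_4)
  (lambda1 lambda2 mu1 mu2 beta theta1 theta2 : R)
  (hOmega : bounded_smooth_domain Omega)
  (hmu1 : 0 < mu1) (hmu2 : 0 < mu2)
  (hmu : mu1 < mu2)
  (hbeta1 : mu1 < beta) (hbeta2 : beta < mu2)
  (htheta2 : theta2 < 0) (htheta1 : 0 < theta1)
  (hlog : 0 < - theta1 * ln (theta1 / (beta - mu1))
              + theta2 * ln (theta2 / (beta - mu2))
              + theta1 - theta2 + lambda2 - lambda1) :
  ~ exists u v : 'rV[R]_4 -> R,
      [/\ weak_solution Omega u (fun x =>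
            lambda1 * u x + mu1 * `|u x| ^+ 2 * u x
            + beta * `|v x| ^+ 2 * u x + theta1 * u x * ln (u x ^+ 2)),
          weak_solution Omega v (fun x =>
            lambda2 * v x + mu2 * `|v x| ^+ 2 * v x
            + beta * `|u x| ^+ 2 * v x + theta2 * v x * ln (v x ^+ 2)),
          positive_in Omega u
        & positive_in Omega v].
Proof.
move=> [u [v [su sv u0 v0]]].
case: hOmega => O0 oO _ _ _.
have [fin eqI] := weak_solution_cross_test su sv.
have muO := L2_measurable su.1.1.1.
have mvO := L2_measurable sv.1.1.1.
set uO := u \_ Omega in muO; set vO := v \_ Omega in mvO.
pose F x := reaction lambda1 mu1 beta theta1 (uO x) (vO x) * vO x.
pose G x := reaction lambda2 mu2 beta theta2 (vO x) (uO x) * uO x.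
have mF : measurable_fun setT F.
  by apply: measurable_funM => //; exact: measurable_reaction.
have mG : measurable_fun setT G.
  by apply: measurable_funM => //; exact: measurable_reaction.
move: fin eqI; rewrite integral_mkcond [X in _ = X -> _]integral_mkcond.
(* Outside Omega the second factors of F and G vanish. *)
rewrite [X in integral _ _ X](_ : _ = EFin \o F); last first.
  apply/funext => x; rewrite /F /uO /vO /= !patchE.
  by case: ifPn; rewrite // mulr0.
rewrite [X in _ = integral _ _ X -> _](_ : _ = EFin \o G); last first.
  apply/funext => x; rewrite /G /uO /vO /= !patchE.
  by case: ifPn; rewrite // mulr0.
move=> finF FG.
have iF : (@lebesgue4 R).-integrable setT (EFin \o F).
  by apply: integral_fin_num_integrable => //; exact/measurable_EFinP.
have iG : (@lebesgue4 R).-integrable setT (EFin \o G).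
  by apply: integral_fin_num_integrable; [exact/measurable_EFinP|rewrite -FG].
apply: (open_not_negligible oO O0).
apply: (@ae_gt0_integral_eq0_negligible _ _ _ _ _ (G \- F)).
- exact: measurable_funB.
- by move=> x xO; rewrite /= /F /G /uO /vO !patchE memNset// !mulr0 subrr.
- apply: filterS2 u0 v0 => x ux vx Ox.
  rewrite /= subr_gt0 /F /G /uO /vO !patchE mem_set//.
  by apply: reaction_cross_lt => //; [exact: ux|exact: vx].
- under eq_integral do rewrite EFinB.
  by rewrite integralB_EFin// -FG subee.
Qed.
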